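(* Let $\mathcal A$ be an Archimedean uniformly complete $f$-algebra, let $p\in\mathbb N$ with $p\ge 2$, and let $g\in\mathcal A$, $u\in\mathcal A_+$. Then $$g\in\Phi_1(\mathcal A)\text{ with a majorant }u\ \Longrightarrow\ g^p\in\Phi_1(\Pi_p(\mathcal A))\text{ with the majorant }u^p.$$ If, in addition, $\mathcal A$ is semiprime, then $$g\in\Phi_1(\mathcal A)\text{ with a majorant }u\ \Longleftrightarrow\ g^p\in\Phi_1(\Pi_p(\mathcal A))\text{ with the majorant }u^p.$$
   Context: An $\ell$-algebra is a real vector lattice $\mathcal A$ with an associative bilinear multiplication such that $a,b\ge 0$ implies $ab\ge 0$; $\mathcal A_+$ is its positive cone. An $f$-algebra is an $\ell$-algebra in which $a\wedge b=0$ and $c\ge 0$ imply $(ac)\wedge b=(ca)\wedge b=0$. All vector lattices are Archimedean. $\mathcal A$ is semiprime if $0$ is its only nilpotent element. $\mathcal A$ is uniformly complete if every relatively uniformly Cauchy sequence converges relatively uniformly. Let $V$ be an Archimedean vector lattice. An element $\varphi\in V$ is finite with majorant $z\in V_+$ if for every $x\in V$ there is a number $c_x>0$ with $|x|\wedge n|\varphi|\le c_x z$ for all $n\in\mathbb N$. $\Phi_1(V)$ denotes the set of all finite elements of $V$ (those having some majorant in $V_+$). For $p\ge 2$ put $\Pi_p(\mathcal A)=\{g_1\cdots g_p : g_1,\dots,g_p\in\mathcal A\}$, with the order and algebraic operations induced from $\mathcal A$. For a uniformly complete $f$-algebra $\mathcal A$ it is known that $\Pi_p(\mathcal A)$ is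 a semiprime uniformly complete $f$-subalgebra of $\mathcal A$, that its positive cone is $\{g^p: g\in\mathcal A_+\}$, that its lattice operations satisfy $f^p\wedge g^p=(f\wedge g)^p$ and $f^p\vee g^p=(f\vee g)^p$ for $f,g\in\mathcal A_+$, and that the modulus of $f_1\cdots f_p$ in $\Pi_p(\mathcal A)$ is $|f_1|\cdots|f_p|$. Finiteness and majorants of $g^p$ are understood in the vector lattice $\Pi_p(\mathcal A)$. *)

(* Defs.v *)
From HB Require Import structures.
From mathcomp Require Import all_boot all_order all_algebra.
From mathcomp Require Import boolp classical_sets reals.

Set Implicit Arguments.
Unset Strict Implicit.
Unset Printing Implicit Defensive.

Import Order.TTheory GRing.Theory Num.Theory.

Local Open Scope classical_set_scope.
Local Open Scope ring_scope.

(* Order.Lattice cannot be joined with GRing.Lmodule: both are inherited by the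
   existing real number structures, with no intermediate structure in between.
   The lattice operations are therefore fields, characterized as the infimum and
   the supremum for the order of the underlying Num.POrderedZmodule. *)
HB.mixin Record isVectorLattice (R : realType) V
    of GRing.Lmodule R V & Num.POrderedZmodule V := {
  vmeet : V -> V -> V;
  vjoin : V -> V -> V;
  vl_lexI : forall x y z : V, (x <= vmeet y z) = (x <= y) && (x <= z);
  vl_leUx : forall x y z : V, (vjoin x y <= z) = (x <= z) && (y <= z);
  vl_leD2r : forall z x y : V, x <= y -> x + z <= y + z;
  vl_scale_ge0 : forall (a : R) (x : V), 0 <= a -> 0 <= x -> 0 <= a *: x
}.

#[short(type="vectorLatticeType")]
HB.structure Definition VectorLattice (R : realType) :=
  { V of GRing.Lmodule R V & Num.POrderedZmodule V & isVectorLattice R V }.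

(* MathComp rings are unital, whereas these algebras need not have a unit: the
   multiplication is the semigroup operation [( _ * _ )%g]. *)
HB.mixin Record isLatticeAlgebra (R : realType) A
    of VectorLattice R A & Semigroup A := {
  la_mulDl : forall x y z : A, ((x + y)%R * z = (x * z)%g + (y * z)%g)%g;
  la_mulDr : forall x y z : A, (x * (y + z)%R = (x * y)%g + (x * z)%g)%g;
  la_scaleAl : forall (a : R) (x y : A), a *: (x * y)%g = (a *: x * y)%g;
  la_scaleAr : forall (a : R) (x y : A), a *: (x * y)%g = (x * (a *: y))%g;
  la_mul_ge0 : forall x y : A, 0 <= x -> 0 <= y -> 0 <= (x * y)%g
}.

#[short(type="lAlgebraType")]
HB.structure Definition LatticeAlgebra (R : realType) :=
  { A of VectorLattice R A & Semigroup A & isLatticeAlgebra R A }.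

HB.mixin Record isFAlgebra (R : realType) A of LatticeAlgebra R A := {
  fa_meetMr : forall a b c : A, vmeet a b = 0 -> 0 <= c ->
    vmeet (a * c)%g b = 0;
  fa_meetMl : forall a b c : A, vmeet a b = 0 -> 0 <= c ->
    vmeet (c * a)%g b = 0
}.

#[short(type="fAlgebraType")]
HB.structure Definition FAlgebra (R : realType) :=
  { A of LatticeAlgebra R A & isFAlgebra R A }.

Section VectorLatticeNotions.
Context {R : realType}.
Implicit Type V : vectorLatticeType R.

Definition modulus V (x : V) : V := vjoin x (- x).

Definition archimedean V : Prop :=
  forall x y : V, 0 <= x -> 0 <= y -> (forall n : nat, x *+ n <= y) -> x = 0.

Definition ru_cauchy V (f : nat -> V) : Prop :=
  exists2 e : V, 0 <= e & forall eps : R, 0 < eps ->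
    exists N : nat, forall m n : nat, (N <= m)%N -> (N <= n)%N ->
      modulus (f m - f n) <= eps *: e.

Definition ru_converges V (f : nat -> V) (l : V) : Prop :=
  exists2 e : V, 0 <= e & forall eps : R, 0 < eps ->
    exists N : nat, forall n : nat, (N <= n)%N ->
      modulus (f n - l) <= eps *: e.

Definition uniformly_complete V : Prop :=
  forall f : nat -> V, ru_cauchy f -> exists l : V, ru_converges f l.

Definition finite_with_majorant V (phi z : V) : Prop :=
  0 <= z /\
  forall x : V, exists2 c : R, 0 < c &
    forall n : nat, vmeet (modulus x) (modulus phi *+ n) <= c *: z.

(* Suprema and infima computed inside a subset S carrying the induced order;
   they need not be those of V. *)
Definition sup_in V (S : set V) (x y s : V) : Prop :=
  [/\ S s, x <= s, y <= s &
      forall t, S t -> x <= t -> y <= t -> s <= t].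

Definition inf_in V (S : set V) (x y s : V) : Prop :=
  [/\ S s, s <= x, s <= y &
      forall t, S t -> t <= x -> t <= y -> t <= s].

(* Finiteness in a subset S that is a vector lattice for the operations and the
   order induced from V. The moduli ax, aphi and the infimum m are those of S,
   which is not assumed to be a sublattice of V; as S is a lattice, they exist
   and are unique. See finite_with_majorant_inE. *)
Definition finite_with_majorant_in V (S : set V) (phi z : V) : Prop :=
  [/\ S phi, S z, 0 <= z &
      forall x : V, S x -> exists2 c : R, 0 < c &
        forall (n : nat) (ax aphi m : V),
          sup_in S x (- x) ax -> sup_in S phi (- phi) aphi ->
          inf_in S ax (aphi *+ n) m -> m <= c *: z].

Lemma sup_in_uniq V (S : set V) (x y s t : V) :
  sup_in S x y s -> sup_in S x y t -> s = t.
Proof.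
move=> [Ss xs ys sP] [St xt yt tP].
by apply/le_anti; rewrite sP // tP.
Qed.

Lemma inf_in_uniq V (S : set V) (x y s t : V) :
  inf_in S x y s -> inf_in S x y t -> s = t.
Proof.
move=> [Ss xs ys sP] [St xt yt tP].
by apply/le_anti; rewrite sP // tP.
Qed.

Lemma finite_with_majorant_inE (V W : vectorLatticeType R)
    (iota : {linear W -> V}) :
  {mono iota : x y / x <= y} ->
  forall phi z : W,
  finite_with_majorant_in (range iota) (iota phi) (iota z) <->
  finite_with_majorant phi z.
Proof.
move=> mon.
have supE (x y : W) : sup_in (range iota) (iota x) (iota y) (iota (vjoin x y)).
  have := lexx (vjoin x y); rewrite vl_leUx => /andP[xj yj].
  split; [by exists (vjoin x y) | by rewrite mon | by rewrite mon |].
  by move=> _ [t _ <-]; rewrite !mon vl_leUx => -> ->.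
have infE (x y : W) : inf_in (range iota) (iota x) (iota y) (iota (vmeet x y)).
  have := lexx (vmeet x y); rewrite vl_lexI => /andP[mx my].
  split; [by exists (vmeet x y) | by rewrite mon | by rewrite mon |].
  by move=> _ [t _ <-]; rewrite !mon vl_lexI => -> ->.
move=> phi z; split.
  move=> [_ _ z0 H]; split; first by rewrite -mon linear0.
  move=> x; have [|c c0 Hc] := H (iota x); first by exists x.
  exists c => // n; rewrite -mon linearZ; apply: (Hc n).
  - by rewrite -linearN; apply: supE.
  - by rewrite -linearN; apply: supE.
  - by rewrite -linearMn; apply: infE.
move=> [z0 H]; split; [by exists phi | by exists z | by rewrite -mon linear0 in z0|].
move=> _ [x _ <-]; have [c c0 Hc] := H x; exists c => // n ax aphi m.
rewrite -!linearN => /sup_in_uniq/(_ (supE _ _))-> /sup_in_uniq/(_ (supE _ _))->.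
by rewrite -linearMn => /inf_in_uniq/(_ (infE _ _))->; rewrite -linearZ mon.
Qed.

End VectorLatticeNotions.

Section FAlgebraNotions.
Context {R : realType}.
Implicit Type A : fAlgebraType R.

(* The value on the empty sequence is junk, as A has no unit. *)
Fixpoint mulseq A (s : seq A) : A :=
  match s with
  | [::] => 0
  | [:: x] => x
  | x :: s' => (x * mulseq s')%g
  end.

(* Meaningful for n > 0 only. *)
Definition apow A (x : A) (n : nat) : A := mulseq (nseq n x).

Definition semiprime A : Prop :=
  forall (x : A) (n : nat), (0 < n)%N -> apow x n = 0 -> x = 0.

Definition Pi A (p : nat) : set A :=
  [set x | exists t : p.-tuple A, x = mulseq t].

End FAlgebraNotions.

Arguments archimedean {R} V.
Arguments uniformly_complete {R} V.
Arguments semiprime {R} A.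
Arguments Pi {R} A p.

(* Main.v *)
Require Import Defs.
From mathcomp Require Import all_boot all_order all_algebra.
From mathcomp Require Import boolp classical_sets reals.

Import Order.TTheory GRing.Theory Num.Theory.

Local Open Scope ring_scope.

(** Write [q >= 2] for the exponent. The theorem reduces to the identity
    [(x /\ y) ^ q = x ^ q /\ y ^ q] for [x, y >= 0] ([vmeet_apow]), which holds
    in every f-algebra. Put [w = x /\ y]: then [x - w] and [y - w] are disjoint,
    and since multiplication by positive elements preserves disjointness, so
    are [x ^ q - w ^ q] and [y ^ q - w ^ q], which are sums of products
    containing a factor [x - w], respectively [y - w].

    The same preservation of disjointness gives [|x y| = |x| |y|] ([modulusM]),
    so that moduli of products and meets of powers, computed in the algebra,
    already lie in the set of [q]-fold products; hence they are also the
    moduli and meets of that set.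

    If [u] is a majorant of [g] and [f] is a [q]-fold product, choose [x] with
    [|f| <= x ^ q]. From [x /\ n |g| <= c u] for all [n] follows
    [|f| /\ n |g| ^ q <= (x /\ n |g|) ^ q <= c ^ q u ^ q].

    Conversely, if [u ^ q] is a majorant of [g ^ q], taking [|x| ^ q] as test
    element and [n = k ^ q] gives [(|x| /\ k |g|) ^ q <= c u ^ q] for all [k].
    In a semiprime f-algebra, [x ^ q <= y ^ q] with [x, y >= 0] implies
    [x <= y] ([apow_le_inv]): by the identity above [x ^ q = w ^ q], whereas
    [x ^ q >= w ^ q + (x - w) ^ q], so [x - w] is nilpotent and [x = w]. *)

(** * Order and disjointness in vector lattices *)

Section VectorLattice.
Context {R : realType} {V : vectorLatticeType R}.
Implicit Types (x y z t a b : V) (c : R).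

Lemma vl_subr_ge0 x y : (0 <= y - x) = (x <= y).
Proof.
apply/idP/idP => [H|H].
  by have := vl_leD2r x _ _ H; rewrite add0r subrK.
by have := vl_leD2r (- x) _ _ H; rewrite subrr.
Qed.

Lemma vl_leBlDr x y z : (x - y <= z) = (x <= z + y).
Proof. by rewrite -(vl_subr_ge0 (x - y)) opprB addrA vl_subr_ge0. Qed.

Lemma vl_leD x y z t : x <= y -> z <= t -> x + z <= y + t.
Proof.
move=> xy zt; apply: (le_trans (vl_leD2r z _ _ xy)).
by rewrite ![y + _]addrC; apply: vl_leD2r.
Qed.

Lemma vl_addr_ge0 x y : 0 <= x -> 0 <= y -> 0 <= x + y.
Proof. by move=> x0 y0; rewrite -[0]addr0; apply: vl_leD. Qed.

Lemma vl_mulrn_ge0 x n : 0 <= x -> 0 <= x *+ n.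
Proof.
by move=> x0; elim: n => [|n IH]; rewrite ?mulr0n // mulrS vl_addr_ge0.
Qed.

Lemma vl_lerMn2l x m n : 0 <= x -> (m <= n)%N -> x *+ m <= x *+ n.
Proof. by move=> x0 mn; rewrite -vl_subr_ge0 -mulrnBr // vl_mulrn_ge0. Qed.

Lemma vl_lerMn2r x y n : x <= y -> x *+ n <= y *+ n.
Proof.
by move=> xy; elim: n => [|n IH]; rewrite ?mulr0n // !mulrS vl_leD.
Qed.

Lemma vl_scale_le c c' x : 0 <= x -> c <= c' -> c *: x <= c' *: x.
Proof.
by move=> x0 cc; rewrite -vl_subr_ge0 -scalerBl vl_scale_ge0 ?subr_ge0.
Qed.

Lemma vl_double_ge0 x : 0 <= x + x -> 0 <= x.
Proof.
move=> xx; rewrite -[x]scale1r (splitr 1) scalerDl -scalerDr.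
by apply: vl_scale_ge0; rewrite ?divr_ge0 ?ler0n.
Qed.

Lemma vmeet_lel x y : vmeet x y <= x.
Proof. by have := lexx (vmeet x y); rewrite vl_lexI => /andP[]. Qed.

Lemma vmeet_ler x y : vmeet x y <= y.
Proof. by have := lexx (vmeet x y); rewrite vl_lexI => /andP[]. Qed.

Lemma vmeetC x y : vmeet x y = vmeet y x.
Proof. by apply/le_anti; rewrite !vl_lexI !vmeet_lel !vmeet_ler. Qed.

Lemma vmeet_idPl x y : x <= y -> vmeet x y = x.
Proof. by move=> xy; apply/le_anti; rewrite vmeet_lel vl_lexI lexx. Qed.

Lemma vmeetDr x y z : vmeet (x + z) (y + z) = vmeet x y + z.
Proof.
apply/le_anti/andP; split.
  by rewrite -vl_leBlDr vl_lexI !vl_leBlDr vmeet_lel vmeet_ler.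
by rewrite vl_lexI !vl_leD2r ?vmeet_lel ?vmeet_ler.
Qed.

Lemma vmeet_sub_disjoint x y : vmeet (x - vmeet x y) (y - vmeet x y) = 0.
Proof. by rewrite vmeetDr subrr. Qed.

Lemma disjoint_ge0l a b : vmeet a b = 0 -> 0 <= a.
Proof. by move=> <-; apply: vmeet_lel. Qed.

Lemma disjoint_ge0r a b : vmeet a b = 0 -> 0 <= b.
Proof. by move=> <-; apply: vmeet_ler. Qed.

Lemma disjointDl a a' b :
  vmeet a b = 0 -> vmeet a' b = 0 -> vmeet (a + a') b = 0.
Proof.
move=> ab a'b; have a0 := disjoint_ge0l _ _ ab.
have [a'0 b0] := (disjoint_ge0l _ _ a'b, disjoint_ge0r _ _ a'b).
apply/le_anti; rewrite vl_lexI vl_addr_ge0 // b0 !andbT.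
rewrite -[X in _ <= X]ab vl_lexI vmeet_ler andbT.
(* The meet lies below both a' + a and b + a, hence below (a' /\ b) + a. *)
rewrite -[X in _ <= X]add0r -a'b -vmeetDr vl_lexI addrC vmeet_lel /=.
by apply: le_trans (vmeet_ler _ _) _; rewrite -vl_subr_ge0 addrC addKr.
Qed.

Lemma disjointDr a b b' :
  vmeet a b = 0 -> vmeet a b' = 0 -> vmeet a (b + b') = 0.
Proof. by rewrite !(vmeetC a); apply: disjointDl. Qed.

Lemma modulus_ler x : x <= modulus x.
Proof. by have := lexx (modulus x); rewrite vl_leUx => /andP[]. Qed.

Lemma modulus_leNr x : - x <= modulus x.
Proof. by have := lexx (modulus x); rewrite vl_leUx => /andP[]. Qed.

Lemma modulus_ge0 x : 0 <= modulus x.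
Proof.
apply: vl_double_ge0; rewrite -(subrr x).
by apply: vl_leD; [apply: modulus_ler|apply: modulus_leNr].
Qed.

(** As [|a - b|] dominates [a - b] and [b - a], the difference
    [a + b - |a - b|] lies below both [b + b] and [a + a]; these are disjoint,
    so the difference is at most [0]. *)
Lemma modulus_sub_disjoint a b : vmeet a b = 0 -> modulus (a - b) = a + b.
Proof.
move=> ab; have [a0 b0] := (disjoint_ge0l _ _ ab, disjoint_ge0r _ _ ab).
have sub_le_add x y : 0 <= y -> x - y <= x + y.
  by move=> y0; apply: vl_leD; rewrite // -[- y]sub0r vl_leBlDr vl_addr_ge0.
have aabb : vmeet (a + a) (b + b) = 0.
  by apply: disjointDl; apply: disjointDr.
apply/le_anti/andP; split.
  by rewrite /modulus vl_leUx opprB sub_le_add // [a + b]addrC sub_le_add.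
rewrite -[modulus _]add0r -vl_leBlDr -aabb vl_lexI !vl_leBlDr.
apply/andP; split.
  rewrite -addrA; apply: vl_leD => //; rewrite addrC -vl_leBlDr.
  by have := modulus_leNr (a - b); rewrite opprB.
rewrite addrC -addrA; apply: vl_leD => //; rewrite addrC -vl_leBlDr.
exact: modulus_ler.
Qed.

Lemma ge0_modulus x : 0 <= x -> modulus x = x.
Proof.
move=> x0; rewrite -[x in LHS]subr0 modulus_sub_disjoint ?addr0 //.
by rewrite vmeetC vmeet_idPl.
Qed.

Lemma modulus_decomposition x :
  exists a b, [/\ vmeet a b = 0, x = a - b & modulus x = a + b].
Proof.
exists (x - vmeet x 0), (0 - vmeet x 0).
have D := vmeet_sub_disjoint x 0; have E : x = x - vmeet x 0 - (0 - vmeet x 0).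
  by rewrite sub0r opprK subrK.
by split=> //; rewrite {1}E modulus_sub_disjoint.
Qed.

Lemma sup_in_modulus (S : set V) x :
  S (modulus x) -> sup_in S x (- x) (modulus x).
Proof.
move=> Sx; split=> // [||t _ xt Nxt]; rewrite ?modulus_ler ?modulus_leNr //.
by rewrite /modulus vl_leUx xt.
Qed.

Lemma inf_in_vmeet (S : set V) x y :
  S (vmeet x y) -> inf_in S x y (vmeet x y).
Proof.
move=> Sxy; split=> // [||t _ tx ty]; rewrite ?vmeet_lel ?vmeet_ler //.
by rewrite vl_lexI tx.
Qed.

End VectorLattice.

(** * Products and powers in f-algebras *)

Section FAlgebra.
Context {R : realType} {A : fAlgebraType R}.
Implicit Types (x y z a b w f g : A) (c : R) (s : seq A) (n : nat).

Lemma fa_mul0l x : ((0 : A) * x)%g = 0.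
Proof. by apply: (addrI ((0 : A) * x)%g); rewrite -la_mulDl !addr0. Qed.

Lemma fa_mul0r x : (x * (0 : A))%g = 0.
Proof. by apply: (addrI (x * (0 : A))%g); rewrite -la_mulDr !addr0. Qed.

Lemma fa_mulNl x y : (- x * y)%g = - (x * y)%g.
Proof. by apply/eqP; rewrite -addr_eq0 -la_mulDl addNr fa_mul0l. Qed.

Lemma fa_mulNr x y : (x * - y)%g = - (x * y)%g.
Proof. by apply/eqP; rewrite -addr_eq0 -la_mulDr addNr fa_mul0r. Qed.

Lemma fa_leM x y z w :
  0 <= x -> 0 <= z -> x <= y -> z <= w -> (x * z)%g <= (y * w)%g.
Proof.
move=> x0 z0 xy zw; apply: (@le_trans _ _ (y * z)%g).
  by rewrite -vl_subr_ge0 -fa_mulNl -la_mulDl la_mul_ge0 ?vl_subr_ge0.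
rewrite -vl_subr_ge0 -fa_mulNr -la_mulDr la_mul_ge0 ?vl_subr_ge0 //.
exact: le_trans xy.
Qed.

(** With [x = a - a'] and [y = b - b'] split into disjoint parts, the positive
    terms [ab], [a'b'] of the product [xy] are disjoint from the negative
    terms [ab'], [a'b], because multiplication preserves disjointness. *)
Lemma modulusM x y : modulus (x * y)%g = (modulus x * modulus y)%g.
Proof.
have [a [a' [aa' -> ->]]] := modulus_decomposition x.
have [b [b' [bb' -> ->]]] := modulus_decomposition y.
have [a0 a'0] := (disjoint_ge0l _ _ aa', disjoint_ge0r _ _ aa').
have [b0 b'0] := (disjoint_ge0l _ _ bb', disjoint_ge0r _ _ bb').
have disjM z z' t t' : 0 <= t -> 0 <= t' -> vmeet z z' = 0 ->
    vmeet (z * t)%g (z' * t')%g = 0.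
  move=> t0 t'0 zz'; apply: fa_meetMr => //.
  by rewrite vmeetC; apply: fa_meetMr; rewrite // vmeetC.
have Mdisj z z' t t' : 0 <= t -> 0 <= t' -> vmeet z z' = 0 ->
    vmeet (t * z)%g (t' * z')%g = 0.
  move=> t0 t'0 zz'; apply: fa_meetMl => //.
  by rewrite vmeetC; apply: fa_meetMl; rewrite // vmeetC.
have -> : ((a - a')%R * (b - b')%R)%g =
    ((a * b)%g + (a' * b')%g) - ((a * b')%g + (a' * b)%g).
  rewrite la_mulDl !la_mulDr !fa_mulNl !fa_mulNr opprK opprD.
  by rewrite [- (a' * b)%g + _]addrC addrACA.
rewrite modulus_sub_disjoint; last first.
  have [a'a b'b] : vmeet a' a = 0 /\ vmeet b' b = 0.
    by rewrite (vmeetC a') (vmeetC b').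
  apply: disjointDl; apply: disjointDr.
  - exact: Mdisj.
  - exact: disjM.
  - exact: disjM.
  - exact: Mdisj.
rewrite la_mulDl !la_mulDr.
by rewrite [(a' * b)%g + _]addrC [RHS]addrACA.
Qed.

Lemma modulus_mulseq s : modulus (mulseq s) = mulseq (map (@modulus R A) s).
Proof.
elim: s => [|x [|y s] IH] //; first by rewrite ge0_modulus.
by rewrite [LHS]modulusM IH.
Qed.

Lemma modulus_apow x n : modulus (apow x n) = apow (modulus x) n.
Proof. by rewrite /apow modulus_mulseq map_nseq. Qed.

Lemma apowSS x n : apow x n.+2 = (x * apow x n.+1)%g.
Proof. by []. Qed.

Lemma apow_ge0 x n : 0 <= x -> 0 <= apow x n.
Proof.
by move=> x0; case: n => // n; elim: n => // n IH; rewrite apowSS la_mul_ge0.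
Qed.

Lemma apow_le x y n : 0 <= x -> x <= y -> apow x n <= apow y n.
Proof.
move=> x0 xy; case: n => // n; elim: n => // n IH.
by rewrite !apowSS fa_leM ?apow_ge0.
Qed.

Lemma apow_scale c x n : apow (c *: x) n.+1 = c ^+ n.+1 *: apow x n.+1.
Proof.
elim: n => // n IH; rewrite !apowSS IH -la_scaleAr -la_scaleAl scalerA.
by rewrite -exprSr.
Qed.

Lemma apow_mulrn x k n : apow (x *+ k) n.+1 = apow x n.+1 *+ (k ^ n.+1).
Proof. by rewrite -!scaler_nat apow_scale natrX. Qed.

Lemma apow_superadditive x y n :
  0 <= x -> 0 <= y -> apow x n.+1 + apow y n.+1 <= apow (x + y) n.+1.
Proof.
move=> x0 y0; have xy0 := vl_addr_ge0 _ _ x0 y0.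
elim: n => // n IH; rewrite !apowSS.
apply: (@le_trans _ _ ((x + y)%R * (apow x n.+1 + apow y n.+1)%R)%g).
  rewrite la_mulDl; apply: vl_leD; apply: fa_leM => //; try exact: apow_ge0.
    by rewrite -vl_subr_ge0 addrC addKr apow_ge0.
  by rewrite -vl_subr_ge0 addrK apow_ge0.
by apply: fa_leM => //; apply: vl_addr_ge0; apply: apow_ge0.
Qed.

(** Expanding [x ^ n.+1 - w ^ n.+1] gives a sum of products each having a factor
    [x - w], so everything disjoint from [x - w] is disjoint from it. *)
Lemma disjoint_apowB x w b n : 0 <= x -> 0 <= w ->
  vmeet (x - w) b = 0 -> vmeet (apow x n.+1 - apow w n.+1) b = 0.
Proof.
move=> x0 w0 xwb; elim: n => // n IH; rewrite !apowSS.
have -> : (x * apow x n.+1)%g - (w * apow w n.+1)%g =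
    (x * (apow x n.+1 - apow w n.+1)%R)%g + ((x - w)%R * apow w n.+1)%g.
  by rewrite la_mulDr la_mulDl fa_mulNl fa_mulNr addrA subrK.
apply: disjointDl; first exact: fa_meetMl.
by apply: fa_meetMr => //; apply: apow_ge0.
Qed.

(** Both [x ^ n.+1] and [y ^ n.+1] exceed [(x /\ y) ^ n.+1], by amounts which are
    disjoint because [x - x /\ y] and [y - x /\ y] are. *)
Lemma vmeet_apow x y n : 0 <= x -> 0 <= y ->
  vmeet (apow x n.+1) (apow y n.+1) = apow (vmeet x y) n.+1.
Proof.
move=> x0 y0; set w := vmeet x y.
have w0 : 0 <= w by rewrite vl_lexI x0.
have D : vmeet (apow x n.+1 - apow w n.+1) (apow y n.+1 - apow w n.+1) = 0.
  apply: disjoint_apowB => //; rewrite vmeetC; apply: disjoint_apowB => //.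
  by rewrite vmeetC; apply: vmeet_sub_disjoint.
by rewrite -[LHS](subrK (apow w n.+1)) -vmeetDr D add0r.
Qed.

(** With [w = x /\ y], the hypothesis forces [x ^ n.+1 = w ^ n.+1], so superadditivity
    applied to [x = w + (x - w)] makes [x - w] nilpotent. *)
Lemma apow_le_inv x y n : semiprime A -> 0 <= x -> 0 <= y ->
  apow x n.+1 <= apow y n.+1 -> x <= y.
Proof.
move=> sp x0 y0 xy; set w := vmeet x y.
have w0 : 0 <= w by rewrite vl_lexI x0.
have d0 : 0 <= x - w by rewrite vl_subr_ge0 vmeet_lel.
have xw : apow x n.+1 = apow w n.+1 by rewrite -vmeet_apow // vmeet_idPl.
have := apow_superadditive w (x - w) n w0 d0.
rewrite [w + _]addrC subrK xw -[leRHS]add0r -vl_leBlDr addrAC subrr add0r => dn.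
have /(sp _ n.+1 isT) d : apow (x - w) n.+1 = 0.
  by apply/le_anti; rewrite dn apow_ge0.
by rewrite -(subrK w x) d add0r vmeet_ler.
Qed.

Lemma mulseq_le_apow s x : 0 <= x -> (forall y, y \in s -> modulus y <= x) ->
  modulus (mulseq s) <= apow x (size s).
Proof.
move=> x0; rewrite modulus_mulseq; elim: s => [|y [|z s] IH] // sx.
  by apply: sx; rewrite mem_head.
apply: fa_leM; rewrite ?modulus_ge0 //.
- by have := modulus_ge0 (mulseq (z :: s)); rewrite modulus_mulseq.
- by apply: sx; rewrite mem_head.
by apply: IH => t ts; apply: sx; rewrite in_cons ts orbT.
Qed.

Lemma modulus_bound s : exists2 x, 0 <= x & forall y, y \in s -> modulus y <= x.
Proof.
elim: s => [|z s [x x0 sx]]; first by exists 0.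
have zx := vl_addr_ge0 _ _ (modulus_ge0 z) x0.
exists (modulus z + x) => // y; rewrite in_cons => /predU1P[->|/sx yx].
  by rewrite -[leLHS]addr0; apply: vl_leD.
by rewrite -[leLHS]add0r; apply: vl_leD; rewrite ?modulus_ge0.
Qed.

Lemma Pi_apow x p : Pi A p (apow x p).
Proof. by exists [tuple of nseq p x]. Qed.

(** The modulus of a product [t_1 ... t_q], with [q = p.+1], is at most [x ^ q]
    for any bound [x] of all the [|t_i|]. The meet of [x ^ q] with [n |g| ^ q]
    is therefore at most [(x /\ n |g|) ^ q <= (c u) ^ q] by [vmeet_apow]. *)
Lemma finite_apow p g u : finite_with_majorant g u ->
  finite_with_majorant_in (Pi A p.+1) (apow g p.+1) (apow u p.+1).
Proof.
case=> u0 fin; split; [exact: Pi_apow|exact: Pi_apow|exact: apow_ge0|].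
move=> _ [t ->]; have [x x0 tx] := modulus_bound t.
have [c c0 xc] := fin x; exists (c ^+ p.+1); first exact: exprn_gt0.
move=> n ax ag m [_ _ _ ax_least] [_ _ _ ag_least] [_ max mag _].
have tle : modulus (mulseq t) <= apow x p.+1.
  by rewrite -[in leRHS](size_tuple t); apply: mulseq_le_apow.
have axle : ax <= apow x p.+1.
  apply: ax_least; first exact: Pi_apow.
    exact: le_trans (modulus_ler _) tle.
  exact: le_trans (modulus_leNr _) tle.
have agle : ag <= apow (modulus g) p.+1.
  rewrite -modulus_apow.
  apply: ag_least; rewrite ?modulus_ler ?modulus_leNr //.
  by rewrite modulus_apow; apply: Pi_apow.
(* As n <= n ^ p.+1, the multiple n |g| ^ p.+1 lies below (n |g|) ^ p.+1. *)
have magn : m <= apow (modulus g *+ n) p.+1.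
  apply: (le_trans mag); rewrite apow_mulrn.
  apply: (@le_trans _ _ (apow (modulus g) p.+1 *+ n)).
    exact: vl_lerMn2r.
  apply: vl_lerMn2l; first by apply: apow_ge0; apply: modulus_ge0.
  by case: (n) => // k; rewrite -[leqLHS]expn1 leq_pexp2l.
rewrite -apow_scale.
have gn0 := vl_mulrn_ge0 _ n (modulus_ge0 g).
apply: le_trans (apow_le _ _ _ _ (xc n)); last first.
  by rewrite vl_lexI modulus_ge0.
by rewrite ge0_modulus // -vmeet_apow // vl_lexI magn (le_trans max).
Qed.

(** With [q = p.+1], testing the finiteness of [g ^ q] on [|x| ^ q] and along
    the multiples [k ^ q] only makes both terms of the meet exact [q]-th powers.
    What is bounded is then [(|x| /\ k |g|) ^ q], and [apow_le_inv] extracts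
    the root. *)
Lemma finite_of_finite_apow p g u : semiprime A -> 0 <= u ->
  finite_with_majorant_in (Pi A p.+1) (apow g p.+1) (apow u p.+1) ->
  finite_with_majorant g u.
Proof.
move=> sp u0 [_ _ _ fin]; split=> // x.
have x0 := modulus_ge0 x; have [c c0 xc] := fin _ (Pi_apow (modulus x) p.+1).
have c1 : 1 <= 1 + c by rewrite lerDl ltW.
exists (1 + c) => [|k]; first exact: lt_le_trans c1.
have gk0 := vl_mulrn_ge0 _ k (modulus_ge0 g).
have w0 : 0 <= vmeet (modulus x) (modulus g *+ k) by rewrite vl_lexI x0.
apply: (apow_le_inv _ _ p sp w0).
  by rewrite vl_scale_ge0 // (le_trans ler01).
(* The constant 1 + c is chosen because c <= (1 + c) ^ p.+1: no root of c has
   to be taken. *)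
rewrite apow_scale; apply: (@le_trans _ _ (c *: apow u p.+1)); last first.
  apply: vl_scale_le; first exact: apow_ge0.
  apply: (@le_trans _ _ (1 + c)); first by rewrite lerDr.
  by rewrite exprS ler_peMr ?(le_trans ler01) // exprn_ege1.
have mod_x : modulus (apow (modulus x) p.+1) = apow (modulus x) p.+1.
  by rewrite ge0_modulus ?apow_ge0.
apply: (xc (k ^ p.+1)%N (apow (modulus x) p.+1) (apow (modulus g) p.+1)).
- rewrite -[X in sup_in _ _ _ X]mod_x; apply: sup_in_modulus.
  by rewrite mod_x; apply: Pi_apow.
- rewrite -modulus_apow; apply: sup_in_modulus.
  by rewrite modulus_apow; apply: Pi_apow.
rewrite -apow_mulrn -vmeet_apow //; apply: inf_in_vmeet.
by rewrite vmeet_apow //; apply: Pi_apow.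
Qed.

End FAlgebra.

Theorem theorem11 (R : realType) (A : fAlgebraType R)
    (A_archimedean : archimedean A) (A_complete : uniformly_complete A)
    (p : nat) (p_ge2 : (2 <= p)%N) (g u : A) (u_ge0 : 0 <= u) :
  (finite_with_majorant g u ->
   finite_with_majorant_in (Pi A p) (apow g p) (apow u p)) /\
  (semiprime A ->
   (finite_with_majorant g u <->
    finite_with_majorant_in (Pi A p) (apow g p) (apow u p))).
Proof.
case: p p_ge2 => // p _; split=> [|sp]; first exact: finite_apow.
by split; [apply: finite_apow|apply: finite_of_finite_apow].
Qed.
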